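(* Let $G$ be a connected finite balanced bipartite graph on at least four vertices such that $d(u)+d(v)>1+|N_2(u)\cup N(v)|$ for every pair of vertices $u,v\in V(G)$ with $d(u,v)=3$. Then $G$ is Hamiltonian.
   Context: Graphs have no loops or multiple edges; $d(w)$ is the degree and $N(w)$ the neighbourhood of $w$, $d(u,v)$ the distance. $N_2(u)$ is the set of vertices at distance exactly $2$ from $u$. A bipartite graph is balanced if both colour classes have the same size. A finite graph is Hamiltonian if it has a cycle through all its vertices. *)

(* Defs.v *)
From mathcomp Require Import all_boot.

Set Implicit Arguments.
Unset Strict Implicit.
Unset Printing Implicit Defensive.

(* A finite simple graph is a finType T of vertices together with a symmetric
   and irreflexive adjacency relation e : rel T. *)

Definition nbh (T : finType) (e : rel T) (u : T) : {set T} :=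
  [set v | e u v].

Definition deg (T : finType) (e : rel T) (u : T) : nat := #|nbh e u|.

(* Walks with exactly n edges, repetitions allowed. *)
Definition walk (T : finType) (e : rel T) (n : nat) (u v : T) : bool :=
  [exists p : n.-tuple T, path e u p && (last u p == v)].

(* d(u, v) = n.  As a relation this needs no value for disconnected pairs. *)
Definition at_dist (T : finType) (e : rel T) (n : nat) (u v : T) : bool :=
  walk e n u v && [forall m : 'I_n, ~~ walk e m u v].

Definition nbh2 (T : finType) (e : rel T) (u : T) : {set T} :=
  [set v | at_dist e 2 u v].

Definition connected_graph (T : finType) (e : rel T) : Prop :=
  forall u v : T, connect e u v.

(* The colour classes are A and its complement. *)
Definition bipartition (T : finType) (e : rel T) (A : {set T}) : Prop :=
  forall u v : T, e u v -> (u \in A) != (v \in A).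

Definition balanced_bipartite (T : finType) (e : rel T) : Prop :=
  exists A : {set T}, bipartition e A /\ #|A| = #|~: A|.

(* The size condition rules out the degenerate ucycles: the empty sequence,
   and an edge traversed back and forth. *)
Definition hamiltonian (T : finType) (e : rel T) : Prop :=
  exists c : seq T, [/\ 2 < size c, ucycle e c & forall x : T, x \in c].

(* Main.v *)
(* Take a longest path P whose ends have opposite colours.  If the first vertex
   x has all its neighbours on P, and b, z are the two vertices following some
   neighbour of x on P, then x, z are adjacent or at distance 3; in the latter
   case the degree condition makes z adjacent to the predecessor of a neighbour
   of x, and a Posa rotation yields a path whose first vertex is adjacent to z.
   Advancing in this way closes P into a cycle C.  By maximality the vertices
   off C are adjacent only to vertices of C.  If C is not spanning, balance
   gives x, y off C of opposite colours; exchanging x with vertices of C brings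
   a neighbour of x and a neighbour of y on C closer and closer, until they are
   consecutive and C opens up to a path longer than P. *)
Require Import Defs.
From mathcomp Require Import all_boot.
From Stdlib Require Import Lia.

Set Implicit Arguments.
Unset Strict Implicit.
Unset Printing Implicit Defensive.

(** * Successors and predecessors along cycles *)

Lemma next_cat (T : eqType) (l1 l2 : seq T) (a b : T) :
  uniq (l1 ++ a :: b :: l2) -> next (l1 ++ a :: b :: l2) a = b.
Proof.
by move=> Uc; rewrite -(next_rot (size l1) Uc) rot_size_cat /= eqxx.
Qed.

Lemma prev_cat (T : eqType) (x : T) (l1 l2 : seq T) (u : T) :
  uniq (x :: l1 ++ u :: l2) -> prev (x :: l1 ++ u :: l2) u = last x l1.
Proof.
case/lastP: l1 => [|l1 a] Uc.
  by rewrite -{2}(next_cat (l1 := [::]) Uc) prev_next.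
have cE : x :: rcons l1 a ++ u :: l2 = (x :: l1) ++ a :: u :: l2.
  by rewrite cat_rcons.
by rewrite last_rcons; rewrite cE in Uc *; rewrite -{2}(next_cat Uc) prev_next.
Qed.

(** If [c] contained all of [~: B], the successor map would send [~: B] injectively into [B] without
    [z], contradicting balance. *)
Lemma missed_other_colour (T : finType) (e : rel T) (B : {set T}) c z :
    bipartition e B -> #|~: B| = #|B| -> ucycle e c -> z \in B -> z \notin c ->
  exists2 y, y \notin c & y \notin B.
Proof.
move=> B_bip B_bal /andP[ec Uc] zB zc.
case: (boolP (~: B \subset c)) => [BCc|/subsetPn[y]]; last first.
  by rewrite inE; exists y.
have next_inj : injective (next c) := can_inj (prev_next Uc).
have : next c @: (~: B) \subset B :\ z.
  apply/subsetP=> _ /imsetP[u uB ->]; have uc := subsetP BCc u uB.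
  rewrite !inE in uB *; apply/andP; split.
    by apply: contraNneq zc => <-; rewrite mem_next.
  by have := B_bip _ _ (next_cycle ec uc); rewrite (negPf uB); case: (_ \in B).
move/subset_leq_card; rewrite card_imset // B_bal (cardsD1 z B) zB.
by rewrite ltnn.
Qed.

(** * Colours, distances and the degree condition *)

Section LocalMoonMoser.

Variables (T : finType) (e : rel T) (A : {set T}).
Hypotheses (e_sym : symmetric e) (A_bip : bipartition e A).
Hypothesis e_deg : forall u v : T, at_dist e 3 u v ->
  deg e u + deg e v > 1 + #|nbh2 e u :|: nbh e v|.

Lemma colour_adj u v : e u v -> (v \in A) = (u \notin A).
Proof. by move/A_bip; do 2!case: (_ \in A). Qed.

Lemma walk0 u v : walk e 0 u v = (u == v).
Proof.
apply/existsP/eqP => [[p]|->]; first by rewrite tuple0 => /eqP.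
by exists [tuple]; rewrite /= eqxx.
Qed.

Lemma walk_colour n u v : walk e n u v -> (v \in A) = odd n (+) (u \in A).
Proof.
case/existsP=> -[p /= /eqP<-] /andP[+ /eqP<-].
elim: p u => //= w s IHs u /andP[uw /IHs->].
by rewrite (colour_adj uw) addNb addbN.
Qed.

Lemma walk1 u v : walk e 1 u v = e u v.
Proof.
apply/existsP/idP => [[p]|uv]; last by exists [tuple v]; rewrite /= uv eqxx.
case/tupleP: p => w p; rewrite tuple0 /= andbT.
by case/andP=> uw /eqP<-.
Qed.

Lemma at_dist2 x u w : x != w -> e x u -> e u w -> at_dist e 2 x w.
Proof.
move=> xw xu uw; apply/andP; split.
  by apply/existsP; exists [tuple u; w]; rewrite /= xu uw eqxx.
apply/forallP; case; case=> [|[|]] //= _; first by rewrite walk0.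
apply/negP=> /walk_colour; rewrite (colour_adj uw) (colour_adj xu) negbK /=.
by case: (_ \in A).
Qed.

Lemma at_dist3 x a b z :
  e x a -> e a b -> e b z -> ~~ e x z -> at_dist e 3 x z.
Proof.
move=> xa ab bz xz; apply/andP; split.
  by apply/existsP; exists [tuple a; b; z]; rewrite /= xa ab bz eqxx.
have zE : (z \in A) = (x \notin A).
  by rewrite (colour_adj bz) (colour_adj ab) (colour_adj xa) negbK.
apply/forallP; case; case=> [|[|[|]]] //= _; first 1 last.
- by rewrite walk1.
- by apply/negP=> /walk_colour; rewrite zE; case: (_ \in A).
- by apply/negP=> /walk_colour; rewrite zE; case: (_ \in A).
Qed.

(* With [f] sending a neighbour of [x] to its successor (or predecessor) on a
   cycle or path, the hypothesis at distance 3 leaves no room in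
   [N_2(x) :|: N(z)] for all these images to avoid [N(z)]. *)
Lemma exchange x a b z u0 (f : T -> T) :
    e x a -> e a b -> e b z -> ~~ e x z -> e x u0 -> injective f ->
    (forall u, e x u -> u != u0 -> e u (f u) /\ f u != x) ->
  exists u, [/\ e x u, u != u0 & e (f u) z].
Proof.
move=> xa ab bz xz xu0 f_inj fP.
(* Leaving out [u0] costs one unit of [deg e x], which is exactly the 1 in the degree condition. *)
pose S := [set f u | u in nbh e x :\ u0].
have cardS : (#|S|).+1 = deg e x.
  by rewrite card_imset // /deg (cardsD1 u0 (nbh e x)) inE xu0.
have sub_S : S \subset nbh2 e x.
  apply/subsetP=> w /imsetP[u /setD1P[uu0]]; rewrite inE => xu ->.
  by have [ufu fux] := fP u xu uu0; rewrite inE (at_dist2 _ xu) // eq_sym.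
have : S :&: nbh e z != set0.
  apply/eqP=> SI0; have := e_deg (at_dist3 xa ab bz xz).
  rewrite -cardS ltnNge addSn add1n ltnS => /negP; apply.
  have := subset_leq_card (setSU (nbh e z) sub_S).
  by rewrite cardsU SI0 cards0 subn0.
case/set0Pn=> w /setIP[/imsetP[u /setD1P[uu0]]]; rewrite !inE => xu -> zfu.
by exists u; split=> //; rewrite e_sym.
Qed.

(** * Longest paths with ends of opposite colours *)

(** The vertices are [x :: p], so [size p] counts the edges. Opposite colours at the ends are what a
    closing edge needs, and they persist when a new neighbour is added at each end. *)
Definition bpath x p :=
  [&& path e x p, uniq (x :: p) & (x \in A) != (last x p \in A)].

Lemma path_rev x p : path e (last x p) (rev (belast x p)) = path e x p.
Proof. by rewrite rev_path; apply: eq_path => u v; rewrite e_sym. Qed.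

Lemma last_rev_belast (x : T) p : last (last x p) (rev (belast x p)) = x.
Proof. by case: p => //= y p; rewrite rev_cons last_rcons. Qed.

Lemma rev_belast (x : T) p : last x p :: rev (belast x p) = rev (x :: p).
Proof. by rewrite -rev_rcons -lastI. Qed.

Lemma bpath_rev x p : bpath x p -> bpath (last x p) (rev (belast x p)).
Proof.
case/and3P=> xp Up cp; apply/and3P; split; first by rewrite path_rev.
  by rewrite rev_belast rev_uniq.
by rewrite last_rev_belast eq_sym.
Qed.

Variable m : nat.
Hypothesis m_max : forall x p, bpath x p -> size p <= m.

(** Otherwise both ends could be extended at once; the two new vertices are distinct because their
    colours differ. *)
Lemma longest_bpath_nbh x p y1 y2 : bpath x p -> size p = m ->
  e x y1 -> e (last x p) y2 -> (y1 \in x :: p) || (y2 \in x :: p).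
Proof.
case/and3P=> xp Up cp szp xy1 xy2; apply: contraT; rewrite negb_or.
case/andP=> y1p y2p; suff /m_max : bpath y1 (x :: rcons p y2).
  by rewrite /= size_rcons szp ltnNge leqnSn.
have col : (y1 \in A) != (y2 \in A).
  by move: cp; rewrite (colour_adj xy1) (colour_adj xy2); do 2!case: (_ \in A).
rewrite /bpath /= e_sym xy1 rcons_path xp xy2 last_rcons col andbT /=.
move: Up => /= /andP[xNp Up]; rewrite rcons_uniq Up.
move: y1p y2p; rewrite !inE !mem_rcons !inE !negb_or => /andP[-> ->].
case/andP=> y2x ->; rewrite xNp (eq_sym x) y2x !andbT.
by apply: contraNneq col => ->.
Qed.

(** Here [t] is the part of the path beyond some neighbour of [x]; the induction shortens it until
    the path closes. The second outcome records the end [v] and the vertex set, so that the argument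
    can be repeated from the other end. *)
Lemma close_bpath n s t x v : size t <= n ->
    bpath x (s ++ t) -> size (s ++ t) = m -> last x (s ++ t) = v ->
    e x (last x s) ->
  (exists c, ucycle e c /\ size c = m.+1) \/
  (exists x' p y, [/\ bpath x' p, last x' p = v, x' :: p =i x :: s ++ t,
                      e x' y & y \notin x' :: p]).
Proof.
elim: n s t x => [|n IHn] s t x.
  case: t => // _; rewrite cats0 => /and3P[xs Us _] szs _ xl.
  left; exists (x :: s); split; last by rewrite /= szs.
  by rewrite /ucycle Us /= rcons_path xs e_sym xl.
case: (hasP (a := e x) (s := t)) => [[u ut xu] szt bp szst lv xl|noN].
  case/splitPr: ut szt bp szst lv => t1 t2 szt.
  rewrite -cat_rcons catA => bp szst lv; apply: (IHn _ _ _ _ bp) => //.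
    by move: szt; rewrite size_cat /= addnS ltnS; apply/leq_trans/leq_addl.
  by rewrite last_cat last_rcons.
case: t noN => [|b [|z t]] noN.
- by move=> _; apply: IHn.
(* A single remaining vertex [b] would be the end of the path and have the colour of [x]. *)
- move=> _ /and3P[+ _ +] _ _ xl; rewrite cat_path last_cat /= andbT.
  case/andP=> _ lb; rewrite (colour_adj lb) (colour_adj xl).
  by case: (_ \in A).
move=> szt bp szst lv xl.
have [xp Up cp] := and3P bp.
case: (altP (allP (a := fun y => y \in x :: s ++ [:: b, z & t])
                  (s := enum (nbh e x)))) => [inN|/allPn[y]]; last first.
  by rewrite mem_enum inE => xy yN; right; do 3!eexists; split; eauto.
have {}inN y : e x y -> y \in x :: s.
  move=> xy; have /inN : y \in enum (nbh e x) by rewrite mem_enum inE.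
  rewrite !(inE, mem_cat) => /or3P[-> //|->|]; first by rewrite orbT.
  by rewrite -!in_cons => yt; case: noN; exists y.
have irr y : e x y -> y != x.
  by move=> xy; apply: contraTneq (A_bip xy) => ->; rewrite eqxx.
have {}inN y : e x y -> y \in s.
  by move=> xy; move: (inN y xy); rewrite inE (negPf (irr y xy)).
case: s xl inN xp Up bp cp szst lv => [/= xx inN|u0 s xl inN xp Up bp cp szst lv].
  by have := inN _ xx.
have [xl' lb bz] : [/\ e x (last x (u0 :: s)), e (last x (u0 :: s)) b & e b z].
  by split=> //; move: xp; rewrite cat_path => /andP[_ /and3P[]].
have xz : ~~ e x z.
  by apply/negP=> xz; apply: noN; exists z; rewrite // !inE eqxx orbT.
have xu0 : e x u0 by move: xp => /= /andP[].
have split_s u : e x u -> u != u0 -> exists s1 s2,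
    (u0 :: s) ++ [:: b, z & t] = (u0 :: s1) ++ u :: s2 ++ [:: b, z & t].
  move=> xu uu0; have := inN u xu; rewrite inE (negPf uu0) /= => us.
  by case/splitPr: us => s1 s2; exists s1, s2; rewrite /= -catA.
(* The first step [u0] of the path is left out because its predecessor is [x] itself. *)
have [||u [xu uu0 fz]] :=
  exchange xl' lb bz xz xu0 (f := prev (x :: (u0 :: s) ++ [:: b, z & t])).
- exact: can_inj (next_prev Up).
- move=> u xu uu0; have [s1 [s2 sE]] := split_s u xu uu0.
  rewrite sE in Up xp *; rewrite prev_cat //; split.
    by move: xp; rewrite cat_path => /andP[_ /andP[]]; rewrite e_sym.
  apply: contraTneq Up => lx; rewrite -lx cons_uniq negb_and negbK /=.
  by rewrite -cat_cons mem_cat mem_last.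
have [s1 [s2 sE]] := split_s u xu uu0.
have prevE : prev (x :: (u0 :: s) ++ [:: b, z & t]) u = last x (u0 :: s1).
  by rewrite sE in Up *; rewrite prev_cat.
rewrite prevE in fz.
rewrite sE {split_s prevE inN xl xl' lb} in Up bp xp szst lv cp *.
set y := last x (u0 :: s1) in fz.
have [xs1 yu us2] :
    [/\ path e x (u0 :: s1), e y u & path e u (s2 ++ [:: b, z & t])].
  by move: xp; rewrite cat_path => /and3P[].
(* Posa rotation: the new path starts at [y], runs back to [x], jumps to [u] and goes on as before.
   Now [s'] ends in [z], a neighbour of [y], and [b], [z] have left the remaining part. *)
pose s' := rev (belast x (u0 :: s1)) ++ u :: s2 ++ [:: b; z].
have s't : s' ++ t = rev (belast x (u0 :: s1)) ++ u :: s2 ++ [:: b, z & t].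
  by rewrite /s' -!catA /= -catA.
have ls't : last y (s' ++ t) = v.
  by rewrite s't -lv /= !last_cat /= !last_cat.
have eqi : y :: s' ++ t =i x :: (u0 :: s1) ++ u :: s2 ++ [:: b, z & t].
  move=> w; rewrite s't -cat_cons rev_belast mem_cat mem_rev.
  by rewrite -[in RHS]cat_cons [in RHS]mem_cat.
have Us' : uniq (y :: s' ++ t).
  rewrite s't -cat_cons rev_belast.
  rewrite (perm_uniq (s2 := x :: (u0 :: s1) ++ u :: s2 ++ [:: b, z & t])) //.
  by rewrite -[X in perm_eq _ X]cat_cons perm_cat2r perm_rev.
have [|||||hc|[x' [p [y' [bp' lp' eqi' xy' y'N]]]]] := IHn s' t y.
- by move: szt => /= ?; rewrite -ltnS ltnW.
- apply/and3P; split=> //.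
    by rewrite s't cat_path path_rev xs1 last_rev_belast /= xu us2.
  rewrite ls't -lv; rewrite e_sym in yu.
  by move: cp; rewrite (colour_adj yu) (colour_adj xu) negbK.
- rewrite -szst s't size_cat size_rev size_belast.
  by rewrite [in RHS]size_cat.
- exact: ls't.
- by rewrite /s' last_cat /= last_cat.
- by left.
by right; exists x', p, y'; split=> // w; rewrite eqi' eqi.
Qed.

(** If closing fails, the new first vertex has a neighbour off the path. Reversing and trying again
    keeps that vertex as the end; a second failure gives both ends neighbours off the path, against
    [longest_bpath_nbh]. *)
Lemma longest_bpath_cycle x p : bpath x p -> size p = m ->
  exists c, ucycle e c /\ size c = m.+1.
Proof.
have close y q : bpath y q -> size q = m ->
    (exists c, ucycle e c /\ size c = m.+1) \/
    (exists x' p' z, [/\ bpath x' p', last x' p' = last y q,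
                         x' :: p' =i y :: q, e x' z & z \notin x' :: p']).
  case: q => [|u q] bq szq; first by case/and3P: bq; rewrite /= eqxx.
  apply: (@close_bpath _ [:: u] q y _ (leqnn _)) => //.
  by case/and3P: bq => /= /andP[].
have eq_size y q y' q' : bpath y q -> bpath y' q' -> y :: q =i y' :: q' ->
    size q = size q'.
  move=> /and3P[_ U _] /and3P[_ U' _] eqi.
  by apply: succn_inj; have /perm_size := uniq_perm U U' eqi.
move=> bp szp; case: (close x p bp szp) => // -[x1 [p1 [y1 [bp1 _ eqi1 xy1 y1N]]]].
have szp1 : size p1 = m by rewrite (eq_size _ _ _ _ bp1 bp eqi1).
have szr : size (rev (belast x1 p1)) = m by rewrite size_rev size_belast.
case: (close _ _ (bpath_rev bp1) szr) => //.
rewrite last_rev_belast => -[x2 [p2 [y2 [bp2 lp2 eqi2 xy2 y2N]]]].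
have {}eqi2 : x2 :: p2 =i x1 :: p1.
  by move=> z; rewrite eqi2 rev_belast mem_rev.
have szp2 : size p2 = m by rewrite (eq_size _ _ _ _ bp2 bp1 eqi2).
have := longest_bpath_nbh bp2 szp2 xy2 (y2 := y1).
by rewrite lp2 (negPf y2N) eqi2 (negPf y1N) => /(_ xy1).
Qed.

(** * Vertices off a cycle of [m.+1] vertices *)

(** A neighbour [y] of [x] off the cycle would give the path [y], [x], [u] and on around the cycle,
    which is too long. *)
Lemma cycle_nbh c x u : ucycle e c -> size c = m.+1 ->
  x \notin c -> u \in c -> e x u -> {subset nbh e x <= c}.
Proof.
move=> ec szc xc uc xu y; rewrite inE => xy; apply: contraT => yc.
case/rot_to: uc => i p rotc.
move: ec; rewrite -(rot_ucycle i) rotc /ucycle /= rcons_path.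
case/andP=> /andP[up lu] Up; move: xc yc szc.
have memc z : (z \in c) = (z \in u :: p) by rewrite -rotc mem_rot.
rewrite !memc -(size_rot i c) rotc => xp yp [szp].
suff /m_max : bpath y (x :: u :: p) by rewrite /= szp ltnNge leqnSn.
apply/and3P; split; first by rewrite /= e_sym xy xu up.
  rewrite !cons_uniq Up xp inE negb_or yp !andbT.
  by apply: contraTneq (A_bip xy) => ->; rewrite eqxx.
rewrite /= (colour_adj xy).
rewrite -[last u p \in A]negbK -(colour_adj lu) (colour_adj xu) negbK.
by case: (_ \in A).
Qed.

(* Induction on the length of the segment of the cycle from [u] to [w]: the
   exchange trades [x] for the successor of [u], which shortens it by two. *)
Lemma no_cross_segment n s1 s2 x y u w : size s1 <= n ->
    ucycle e (u :: s1 ++ w :: s2) -> size (u :: s1 ++ w :: s2) = m.+1 ->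
    x \notin u :: s1 ++ w :: s2 -> y \notin u :: s1 ++ w :: s2 ->
    e x u -> e y w -> (x \in A) != (y \in A) -> False.
Proof.
elim: n s1 s2 x y u w => [|n IHn] s1 s2 x y u w.
  (* With [u], [w] consecutive, the cycle opens into a path from [y] through [w], around to [u], and
     on to [x]. *)
  case: s1 => // _ /andP[+ Uc] [szc] xc yc xu yw col.
  rewrite /= rcons_path => /and3P[uw ws2 lu].
  suff /m_max : bpath y (w :: s2 ++ [:: u; x]).
    by rewrite /= size_cat /= -szc addn2 ltnNge leqnSn.
  apply/and3P; split.
  - by rewrite /= yw cat_path ws2 /= lu e_sym xu.
  - have pE : perm_eq (y :: w :: s2 ++ [:: u; x]) [:: y, u, x, w & s2].
      by rewrite perm_cons -cat_cons perm_catC.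
    move: Uc xc yc; rewrite (perm_uniq pE) /= !inE !negb_or.
    case/and3P=> /andP[-> ->] -> -> /and3P[xu' -> ->] /and3P[-> -> ->].
    by rewrite (eq_sym u) xu' !andbT; apply: contraNneq col => ->.
  - by rewrite /= last_cat /= eq_sym.
move=> szs1 ec szc xc yc xu yw col.
pose c := u :: s1 ++ w :: s2; have [cc Uc] := andP ec.
(* A neighbour of [x] or of [y] inside the segment replaces [u] or [w] and shortens it. *)
case: (hasP (a := e x) (s := s1)) => [[u' us xu']|noX].
  case/splitPr: us szs1 @c {cc Uc} ec szc xc yc => a b sza c ec szc xc yc.
  have rE : rot (size (u :: a)) c = (u' :: b ++ w :: (s2 ++ u :: a)).
    have -> : c = (u :: a) ++ u' :: b ++ w :: s2 by rewrite /c /= -catA.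
    by rewrite rot_size_cat /= -catA.
  apply: (IHn b (s2 ++ u :: a) x y u' w) => //; rewrite -?rE.
  - by move: sza; rewrite size_cat /= addnS ltnS; apply/leq_trans/leq_addl.
  - by rewrite rot_ucycle.
  - by rewrite size_rot.
  - by rewrite mem_rot.
  - by rewrite mem_rot.
case: (hasP (a := e y) (s := s1)) => [[w' ws yw']|noY].
  case/splitPr: ws szs1 @c {cc Uc noX} ec szc xc yc => a b sza.
  rewrite -catA cat_cons => c ec szc xc yc.
  apply: (IHn a (b ++ w :: s2) x y u w') => //.
  by move: sza; rewrite size_cat /= addnS ltnS; apply/leq_trans/leq_addr.
have xN : {subset nbh e x <= c} by apply: cycle_nbh xu; rewrite ?inE ?eqxx.
case: s1 => [|c1 [|c2 s1]] in szs1 @c ec szc xc yc cc Uc noX noY xN *.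
- by apply: (IHn [::] s2 x y u w).
(* A segment with one inner vertex would give [x] and [y] the same colour. *)
- move: cc; rewrite /= => /and3P[uc1 c1w _].
  move: col (colour_adj xu) (colour_adj yw) (colour_adj uc1) (colour_adj c1w).
  by do 5!case: (_ \in A).
have [uc1 c12 cs1 {}cc] : [/\ e u c1, e c1 c2, path e c2 s1 &
    path e (last c2 s1) (rcons (w :: s2) u)].
  by move: cc; rewrite /= rcons_cat cat_path => /and4P[].
have xc2 : ~~ e x c2.
  by apply/negP=> xc2; apply: noX; exists c2; rewrite // !inE eqxx orbT.
have irr z : e x z -> z \in c by move=> xz; apply: xN; rewrite inE.
have [|u' xu' u'u|u' [xu' u'u fc2]] := exchange xu uc1 c12 xc2 xu (f := next c).
- exact: can_inj (prev_next Uc).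
- split; first by apply: (next_cycle (p := c)); [case/andP: ec | exact: irr].
  by apply: contraNneq xc => <-; rewrite mem_next irr.
have u'W : u' \in w :: s2.
  have := irr u' xu'; rewrite inE (negPf u'u) mem_cat /= => /orP[u'W|//].
  by case: noX; exists u'.
(* The vertex [u'] is not the last one listed: its successor would be [u], which has the colour of
   [c2] and cannot be adjacent to it. *)
have [l1 [b [l2 ws2]]] : exists l1 b l2, w :: s2 = l1 ++ [:: u', b & l2].
  have [l1 [[|b l2] ws2]] : exists l1 l2, w :: s2 = l1 ++ u' :: l2.
  - by case/splitPr: u'W => l1 l2; exists l1, l2.
  - have cE : c = (u :: c1 :: c2 :: s1 ++ l1) ++ [:: u'].
      by rewrite /c ws2 /= -catA.
    have := next_rot (size (u :: c1 :: c2 :: s1 ++ l1)) Uc u'.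
    rewrite -/c {1}cE rot_size_cat [next _ _]/= eqxx => fu'.
    move: fc2; rewrite -fu' => /colour_adj.
    by rewrite (colour_adj c12) (colour_adj uc1) negbK; case: (_ \in A).
  by exists l1, b, l2.
have cE : c = (u :: c1 :: c2 :: s1 ++ l1) ++ [:: u', b & l2].
  by rewrite /c ws2 /= -!catA.
have bc2 : e b c2 by move: fc2; rewrite cE next_cat // -cE.
(* The new cycle follows the old one from [c2] to [u'], passes through [x] to [u], and runs
   backwards to [b], a neighbour of [c2]. It has [x] in place of [c1], so [c1] and [c2] take over
   the roles of [x] and [u]. *)
pose c' := c2 :: s1 ++ l1 ++ [:: u'; x; u] ++ rev (b :: l2).
have pE : perm_eq (c1 :: c') (x :: c).
  apply/permP=> a; rewrite /c' cE /= !(count_cat, count_rev) /= ?count_cat ?count_rev /=.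
  rewrite -?plusE; lia.
have [s2' c'E] : exists s2', c' = c2 :: s1 ++ w :: s2'.
  rewrite /c'; case: (l1) ws2 => [|w' l1'] [-> _]; first by eexists.
  by eexists; rewrite cat_cons.
have Uc' : uniq (c1 :: c').
  by rewrite (perm_uniq pE) cons_uniq xc.
apply: (IHn s1 s2' c1 y c2 w) => //; rewrite -?c'E.
- by move: szs1 => /= ?; rewrite -ltnS ltnW.
- apply/andP; split; last by move: Uc'; rewrite cons_uniq => /andP[].
  move: cc; rewrite ws2 rcons_cat cat_path /= => /and4P[pl1 lu' u'b bl2].
  have urev : path e u (rev (b :: l2)).
    by rewrite -[b :: l2](belast_rcons _ _ u) -{1}(last_rcons b l2 u) path_rev.
  rewrite /c' /= -cats1 -!catA cat_path cs1 cat_path pl1 /= lu' e_sym xu' xu.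
  by rewrite cat_path urev rev_cons last_rcons /= bc2.
- by have := perm_size pE; rewrite /= => -[->].
- by move: Uc'; rewrite cons_uniq => /andP[].
- have : y \notin c1 :: c'.
    by rewrite (perm_mem pE) inE negb_or yc andbT; apply: contraNneq col => ->.
  by rewrite inE negb_or => /andP[].
- by rewrite (colour_adj uc1) (colour_adj xu) negbK.
Qed.

(** * The cycle is spanning *)

(** By [cycle_nbh], the cycle together with its neighbours is closed under adjacency, hence
    everything by connectedness. *)
Lemma longest_cycle_dominating c : connected_graph e ->
  ucycle e c -> size c = m.+1 ->
  forall x, x \notin c -> exists2 u, u \in c & e x u.
Proof.
move=> e_conn ec szc x xc.
pose a := [pred z | (z \in c) || [exists u in c, e z u]].
have clos_a : closed e a.
  apply: intro_closed; first by apply: sym_connect_sym.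
  move=> y z yz; rewrite !inE; case: (boolP (y \in c)) => [yc _|yc /= yN].
    by apply/orP; right; apply/existsP; exists y; rewrite yc e_sym.
  case/existsP: yN => u /andP[uc yu].
  by rewrite (cycle_nbh ec szc yc uc yu) // inE.
case: c => // z c in ec szc xc a clos_a *.
have : x \in a.
  by rewrite (closed_connect clos_a (e_conn x z)) !inE eqxx.
by rewrite inE (negPf xc) /= => /existsP[u /andP[]]; exists u.
Qed.

Lemma missed_vertices c z : #|A| = #|~: A| -> ucycle e c -> z \notin c ->
  exists x y, [/\ x \notin c, y \notin c & (x \in A) != (y \in A)].
Proof.
move=> A_bal ec zc; case: (boolP (z \in A)) => zA.
  have [y yc yA] := missed_other_colour A_bip (esym A_bal) ec zA zc.
  by exists z, y; rewrite zA (negPf yA).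
have A_bipC : bipartition e (~: A).
  by move=> u v /A_bip; rewrite !inE; do 2!case: (_ \in A).
have zAC : z \in ~: A by rewrite inE.
have AC_bal : #|~: ~: A| = #|~: A| by rewrite setCK.
have [y yc] := missed_other_colour A_bipC AC_bal ec zAC zc.
by rewrite inE negbK => yA; exists z, y; rewrite yA (negPf zA).
Qed.

Lemma longest_cycle_spanning c x : connected_graph e -> #|A| = #|~: A| ->
  ucycle e c -> size c = m.+1 -> x \in c.
Proof.
move=> e_conn A_bal ec szc; apply: contraT => /(missed_vertices A_bal ec).
case=> x1 [y [xc yc col]].
have [u uc xu] := longest_cycle_dominating e_conn ec szc xc.
have [w wc yw] := longest_cycle_dominating e_conn ec szc yc.
case/rot_to: uc => i p rotc.
have uw : w != u.
  apply: contraNneq col => wu; rewrite -[_ \in A]negbK -(colour_adj xu) -wu.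
  by rewrite (colour_adj yw) negbK.
have : w \in u :: p by rewrite -rotc mem_rot.
rewrite inE (negPf uw) /= => wp; case/splitPr: wp rotc => s1 s2 rotc.
have [] := @no_cross_segment _ s1 s2 x1 y u w (leqnn _) _ _ _ _ xu yw col.
- by rewrite -rotc rot_ucycle.
- by rewrite -rotc size_rot.
- by rewrite -rotc mem_rot.
- by rewrite -rotc mem_rot.
Qed.

End LocalMoonMoser.

(** * From a longest path to a Hamiltonian cycle *)

Theorem theorem14 (T : finType) (e : rel T)
    (e_sym : symmetric e) (e_irr : irreflexive e)
    (e_conn : connected_graph e)
    (e_bal : balanced_bipartite e)
    (T_ge4 : 4 <= #|T|)
    (e_deg : forall u v : T, at_dist e 3 u v ->
       deg e u + deg e v > 1 + #|nbh2 e u :|: nbh e v|) :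
  hamiltonian e.
Proof.
have [A [A_bip A_bal]] := e_bal.
have cardT : #|A| + #|A| = #|T| by rewrite {2}A_bal cardsC.
pose P n := [exists x, exists p : n.-tuple T, bpath e A x p].
have bpathP n x p : bpath e A x p -> size p = n -> P n.
  move=> bp szp; apply/existsP; exists x; apply/existsP.
  by exists (Tuple (introT eqP szp)).
(* By balance both colour classes are nonempty; connectedness joins a vertex of one to a vertex of
   the other. *)
have exP : exists n, P n.
  have [x xA] : exists x, x \in A.
    by apply/set0Pn; apply: contraTneq T_ge4 => A0; rewrite -cardT A0 cards0.
  have [y yA] : exists y, y \in ~: A.
    apply/set0Pn; apply: contraTneq T_ge4 => A0.
    by rewrite -cardT A_bal A0 cards0.
  have /connectP[p0 /shortenP[p xp Up _] yE] := e_conn x y.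
  exists (size p); apply: (bpathP _ x p) => //.
  by apply/and3P; split; rewrite // -yE xA; rewrite inE in yA.
have ubP n : P n -> n <= #|T|.
  case/existsP=> x /existsP[p /and3P[_ /= /andP[_ Up] _]].
  by rewrite -(size_tuple p) -(card_uniqP Up) max_card.
case: (ex_maxnP exP ubP) => m /existsP[x /existsP[p bp]] m_ub.
have m_max y q : bpath e A y q -> size q <= m.
  by move=> bq; apply: m_ub; apply: bpathP bq (erefl _).
have [c [ec szc]] :=
  longest_bpath_cycle e_sym A_bip e_deg m_max bp (size_tuple p).
have c_all z : z \in c.
  exact: (longest_cycle_spanning e_sym A_bip e_deg m_max z e_conn A_bal ec szc).
exists c; split=> //.
have : #|T| <= size c.
  by apply: leq_trans (card_size c); apply/subset_leq_card/subsetP=> z _; apply: c_all.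
by apply: leq_trans; apply: ltnW.
Qed.
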